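(* Let $X$ be a real Hilbert space, let $m\ge 2$ be an integer, and let $I=\{1,2,\ldots,m\}$. Let $(T_i)_{i\in I}$ be a family of nonexpansive operators from $X$ to $X$, let $(z_i)_{i\in I}$ and $(y_i)_{i\in I}$ be families in $X$, and let, for each $i\in I$, $(z_{i,n})_{n\in\mathbb{N}}$ be a sequence in $X$ such that for all $i$ and $j$ in $I$, as $n\to\infty$, $$z_{i,n}\rightharpoonup z_i\quad\text{and}\quad T_iz_{i,n}\rightharpoonup y_i,$$ $$\sum_{i\in I}\big(z_{i,n}-T_iz_{i,n}\big)\to\sum_{i\in I}\big(z_i-y_i\big),$$ $$z_{i,n}-z_{j,n}+T_iz_{i,n}-T_jz_{j,n}\to 0.$$ Then $T_iz_i=y_i$ for each $i\in I$.
   Context: $X$ is a real Hilbert space with inner product $\langle\cdot,\cdot\rangle$ and induced norm $\|\cdot\|$. $\rightharpoonup$ denotes weak convergence and $\to$ denotes norm (strong) convergence. A mapping $T\colon X\to X$ is nonexpansive if $\|Tx-Ty\|\le\|x-y\|$ for all $x,y\in X$. *)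

(* Defs.v *)
From mathcomp Require Import all_boot all_order all_algebra.
From mathcomp Require Import all_classical all_reals all_analysis.
Import Order.TTheory GRing.Theory Num.Theory numFieldNormedType.Exports.

Set Implicit Arguments.
Unset Strict Implicit.
Unset Printing Implicit Defensive.

Local Open Scope classical_set_scope.
Local Open Scope ring_scope.

(* A real Hilbert space is a complete normed module [X] over [R] together with
   a form [dot : {dot X for idfun}] (bilinear, symmetric, positive definite)
   satisfying [induces_norm dot]. *)
Definition induces_norm (R : realType) (X : normedModType R)
    (dot : {dot X for idfun}) : Prop :=
  forall x : X, `|x| = Num.sqrt (dot x x).

Definition weakly_cvg (R : realType) (X : normedModType R)
    (dot : {dot X for idfun}) (u : nat -> X) (x : X) : Prop :=
  forall v : X, dot (u n) v @[n --> \oo] --> dot x v.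

Definition nonexpansive (R : realType) (X : normedModType R)
    (T : X -> X) : Prop :=
  forall x y : X, `|T x - T y| <= `|x - y|.

(* Main.v *)
(* Put [a = z - T z] and [b = z + T z].  Nonexpansiveness of [T] says that
   [<a - a', b - b'> = |z - z'|^2 - |T z - T z'|^2] is nonnegative.  Since the
   [b_i,n] asymptotically agree and [\sum_i a_i,n] converges strongly,
   [\sum_i <a_i,n, b_i,n>] converges to the sum of the products of the weak
   limits, so the inequality passes to the weak limits [z_i - y_i], [z_i + y_i].
   Comparing with the point [z_i] itself, it reads
   [0 <= - \sum_i |T_i z_i - y_i|^2]. *)
Require Import Defs.
From mathcomp Require Import all_boot all_order all_algebra.
From mathcomp Require Import all_classical all_reals all_analysis.
From mathcomp Require Import ring.
Import Order.TTheory GRing.Theory Num.Theory numFieldNormedType.Exports.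

Local Open Scope classical_set_scope.
Local Open Scope ring_scope.

Lemma dot_sym {R : realType} {X : normedModType R} (dot : {dot X for idfun})
  (x y : X) : dot x y = dot y x.
Proof. by rewrite hermC expr0 mul1r. Qed.

Lemma dot_ge0 {R : realType} {X : normedModType R} (dot : {dot X for idfun})
  (x : X) : 0 <= dot x x.
Proof.
have [->|x0] := eqVneq x 0; first by rewrite linear0l.
exact/ltW/neq0_dnorm_gt0.
Qed.

Lemma dot_normE {R : realType} {X : normedModType R} {dot : {dot X for idfun}} :
  induces_norm dot -> forall x : X, dot x x = `|x| ^+ 2.
Proof. by move=> hdot x; rewrite hdot sqr_sqrtr// dot_ge0. Qed.

(** Expanding the nonnegative square of [dot y y *: x - dot x y *: y] gives [dot y y] times the Gram
    determinant of [x] and [y]; this choice of vector avoids division. *)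
Lemma cauchy_schwarz {R : realType} {X : normedModType R}
    {dot : {dot X for idfun}} : induces_norm dot ->
  forall x y : X, `|dot x y| <= `|x| * `|y|.
Proof.
move=> hdot x y.
have [->|y0] := eqVneq y 0; first by rewrite linear0r !normr0 mulr0.
have yy0 : 0 < dot y y by exact: neq0_dnorm_gt0.
rewrite -(@ler_pXn2r _ 2)// ?nnegrE ?mulr_ge0// exprMn -!(dot_normE hdot).
rewrite real_normK ?num_real//.
have := dot_ge0 dot (dot y y *: x - dot x y *: y).
rewrite !(linearBl, linearBr, linearZl_LR, linearZr_LR) /= (dot_sym dot y x).
have -> : dot y y * (dot y y * dot x x) - dot x y * (dot y y * dot x y) -
  (dot y y * (dot x y * dot x y) - dot x y * (dot x y * dot y y)) =
  dot y y * (dot x x * dot y y - dot x y ^+ 2) by ring.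
by rewrite pmulr_rge0// subr_ge0.
Qed.

Lemma weakly_cvgD {R : realType} {X : normedModType R}
    {dot : {dot X for idfun}} {u v : nat -> X} {x y : X} :
  weakly_cvg dot u x -> weakly_cvg dot v y ->
  weakly_cvg dot (fun n => u n + v n) (x + y).
Proof.
move=> ux vy w; rewrite linearDl; under eq_fun do rewrite linearDl.
by apply: cvgD; [exact: ux|exact: vy].
Qed.

Lemma weakly_cvgB {R : realType} {X : normedModType R}
    {dot : {dot X for idfun}} {u v : nat -> X} {x y : X} :
  weakly_cvg dot u x -> weakly_cvg dot v y ->
  weakly_cvg dot (fun n => u n - v n) (x - y).
Proof.
move=> ux vy w; rewrite linearBl; under eq_fun do rewrite linearBl.
by apply: cvgB; [exact: ux|exact: vy].
Qed.

(** Testing both limits against [x - y] forces [dot (x - y) (x - y)] to vanish. *)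
Lemma weakly_cvg_unique {R : realType} {X : normedModType R}
    {dot : {dot X for idfun}} {u : nat -> X} {x y : X} :
  weakly_cvg dot u x -> weakly_cvg dot u y -> x = y.
Proof.
move=> ux uy; apply/eqP; rewrite -subr_eq0; apply/negPn/negP => xy0.
have : 0 < dot (x - y) (x - y) by exact: neq0_dnorm_gt0.
have -> : dot (x - y) (x - y) = 0; last by rewrite ltxx.
rewrite linearBl; apply/eqP; rewrite subr_eq0; apply/eqP.
exact: cvg_unique (ux _) (uy _).
Qed.

Lemma cvg_weakly_cvg {R : realType} {X : normedModType R}
    {dot : {dot X for idfun}} {u : nat -> X} {x : X} :
  induces_norm dot -> u n @[n --> \oo] --> x -> weakly_cvg dot u x.
Proof.
move=> hdot ux v; apply/subr_cvg0/norm_cvg0P.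
apply: (@squeeze_cvgr _ _ _ _ (cst 0) (fun n => `|u n - x| * `|v|)).
- by near=> n; rewrite /= normr_ge0 -linearBl cauchy_schwarz.
- exact: cvg_cst.
- rewrite -(mul0r `|v|); apply: cvgM; last exact: cvg_cst.
  by apply/norm_cvg0P/subr_cvg0.
Unshelve. all: by end_near. Qed.

(** Uniform boundedness principle for the functionals [dot (u n)]: they are pointwise bounded
    because convergent real sequences are bounded. Completeness of [X] enters here. *)
Lemma weakly_cvg_bounded {R : realType} {X : completeNormedModType R}
    {dot : {dot X for idfun}} {u : nat -> X} {x : X} :
  induces_norm dot -> weakly_cvg dot u x -> exists M, forall n, `|u n| <= M.
Proof.
move=> hdot ux.
have [||M uM] := @Banach_Steinhauss R X R^o [set dot (u n) | n in setT] _ _ 1.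
- move=> _ [n _ <-]; split; last by move=> a v w; rewrite linearPr.
  move=> r; exists (`|u n| * r) => v vr.
  by rewrite (le_trans (cauchy_schwarz hdot _ _))// ler_wpM2l.
- move=> v; have /cvg_seq_bounded/pinfty_ex_gt0[M _ uM] :
    cvgn (fun n => dot (u n) v) by apply/cvg_ex; exists (dot x v); exact: ux.
  by exists M => _ [n _ <-]; exact: uM.
exists M => n; have [->|un0] := eqVneq (u n) 0.
  rewrite normr0; apply: le_trans (uM _ _ 0 _); last by rewrite normr0.
    exact: normr_ge0.
  by exists n.
(* [M] bounds every functional on the unit ball; at the normalized [u n] the functional [dot (u n)]
   takes the value [|u n|]. *)
have := uM (dot (u n)) _ (`|u n|^-1 *: u n); rewrite linearZr_LR/= dot_normE//.
rewrite expr2 mulKf ?normr_eq0// normr_id; apply; first by exists n.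
by rewrite normrZ normfV normr_id mulVf ?normr_eq0.
Qed.

(** Replacing [v n] by [y] costs [dot (u n) (v n - y)], a bounded factor against a null one; what
    remains is weak convergence tested at [y]. *)
Lemma cvg_dot_weak_strong {R : realType} {X : completeNormedModType R}
    {dot : {dot X for idfun}} {u v : nat -> X} {x y : X} :
  induces_norm dot -> weakly_cvg dot u x -> v n @[n --> \oo] --> y ->
  dot (u n) (v n) @[n --> \oo] --> dot x y.
Proof.
move=> hdot ux vy; have [M uM] := weakly_cvg_bounded hdot ux.
have -> : (fun n => dot (u n) (v n)) =
    (fun n => dot (u n) (v n - y) + dot (u n) y).
  by apply/funext => n; rewrite linearBr subrK.
rewrite -[X in _ --> X]add0r; apply: cvgD; last exact: ux.
apply/norm_cvg0P.
apply: (@squeeze_cvgr _ _ _ _ (cst 0) (fun n => M * `|v n - y|)).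
- near=> n; rewrite /= normr_ge0 (le_trans (cauchy_schwarz hdot _ _))//.
  by rewrite ler_wpM2r.
- exact: cvg_cst.
- rewrite -(mulr0 M); apply: cvgM; first exact: cvg_cst.
  by apply/norm_cvg0P/subr_cvg0.
Unshelve. all: by end_near. Qed.

Lemma dot_subD {R : realType} {X : normedModType R}
    {dot : {dot X for idfun}} (hdot : induces_norm dot) (d e : X) :
  dot (d - e) (d + e) = `|d| ^+ 2 - `|e| ^+ 2.
Proof.
rewrite linearBl !linearDr /= (dot_sym dot e d) !(dot_normE hdot); ring.
Qed.

Theorem theorem3p2 (R : realType) (X : completeNormedModType R)
    (dot : {dot X for idfun}) (hdot : induces_norm dot)
    (m : nat) (hm : (2 <= m)%N)
    (T : 'I_m -> X -> X) (hT : forall i : 'I_m, nonexpansive (T i))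
    (z y : 'I_m -> X) (zn : 'I_m -> nat -> X)
    (hz : forall i : 'I_m, weakly_cvg dot (zn i) (z i))
    (hTz : forall i : 'I_m, weakly_cvg dot (fun n => T i (zn i n)) (y i))
    (hsum : \sum_(i < m) (zn i n - T i (zn i n)) @[n --> \oo]
              --> \sum_(i < m) (z i - y i))
    (hdiff : forall i j : 'I_m,
        zn i n - zn j n + T i (zn i n) - T j (zn j n) @[n --> \oo] --> (0 : X)) :
  forall i : 'I_m, T i (z i) = y i.
Proof.
pose i0 : 'I_m := Ordinal (leq_trans (isT : 0 < 2)%N hm).
pose a i n := zn i n - T i (zn i n).
pose b i n := zn i n + T i (zn i n).
have ha i : weakly_cvg dot (a i) (z i - y i) by exact: weakly_cvgB.
have hb i : weakly_cvg dot (b i) (z i + y i) by exact: weakly_cvgD.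
have hbb i : b i n - b i0 n @[n --> \oo] --> (0 : X).
  have -> : (fun n => b i n - b i0 n) =
    (fun n => zn i n - zn i0 n + T i (zn i n) - T i0 (zn i0 n)).
    by apply/funext => n; rewrite /b opprD addrACA addrA.
  exact: hdiff.
(* The differences [b i n - b i0 n] tend weakly both to the difference of the weak limits and to
   0. *)
have b_const i : z i + y i = z i0 + y i0.
  apply/eqP; rewrite -subr_eq0; apply/eqP.
  by apply: weakly_cvg_unique (weakly_cvgB (hb i) (hb i0)) _; exact: cvg_weakly_cvg.
have hab : \sum_(i < m) dot (a i n) (b i n) @[n --> \oo] -->
    \sum_(i < m) dot (z i - y i) (z i + y i).
  (* A single product [dot (a i n) (b i n)] pairs two merely weak limits. Trading [b i n] for
     [b i0 n] gathers the [a i n] into their strongly convergent sum, and the error terms pair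
     [a i n] with a strongly null sequence. *)
  have -> : (fun n => \sum_(i < m) dot (a i n) (b i n)) =
      (fun n => dot (b i0 n) (\sum_(i < m) a i n) +
                \sum_(i < m) dot (a i n) (b i n - b i0 n)).
    apply/funext => n; rewrite dot_sym linear_sumlz -big_split/=.
    by apply: eq_bigr => i _; rewrite linearBr addrC subrK.
  have -> : \sum_(i < m) dot (z i - y i) (z i + y i) =
      dot (z i0 + y i0) (\sum_(i < m) (z i - y i)) +
      \sum_(i < m) dot (z i - y i) 0.
    rewrite dot_sym linear_sumlz -big_split/=.
    by apply: eq_bigr => i _; rewrite linear0r addr0 b_const.
  apply: cvgD; first exact: cvg_dot_weak_strong.
  apply: cvg_big => [|i _]; first exact: add_continuous.
  exact: cvg_dot_weak_strong.
pose a' i := z i - T i (z i).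
pose b' i := z i + T i (z i).
(* Apart from the sum handled by [hab], everything is affine in [p] and [q], so it passes to weak
   limits. *)
have dot_subsub (p q : 'I_m -> X) :
    \sum_(i < m) dot (p i - a' i) (q i - b' i) = \sum_(i < m) dot (p i) (q i) +
      \sum_(i < m) (dot (a' i) (b' i) - dot (p i) (b' i) - dot (q i) (a' i)).
  rewrite -big_split/=; apply: eq_bigr => i _.
  by rewrite (dot_sym dot (q i) (a' i)) linearBl !linearBr /=; ring.
have hlim : \sum_(i < m) dot (a i n - a' i) (b i n - b' i) @[n --> \oo] -->
    \sum_(i < m) dot (z i - y i - a' i) (z i + y i - b' i).
  rewrite dot_subsub; under eq_fun do rewrite dot_subsub.
  apply: cvgD; first exact: hab.
  apply: cvg_big => [|i _]; first exact: add_continuous.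
  apply: cvgB; last exact: hb.
  by apply: cvgB; [exact: cvg_cst|exact: ha].
have lim_ge0 : 0 <= \sum_(i < m) dot (z i - y i - a' i) (z i + y i - b' i).
  (* Each summand is nonnegative for every [n], by nonexpansiveness of [T i] at [zn i n] and
     [z i]. *)
  apply: (cvgr_to_ge hlim); near=> n; apply: sumr_ge0 => i _.
  have -> : a i n - a' i = (zn i n - z i) - (T i (zn i n) - T i (z i)).
    by rewrite /a /a' !opprD addrACA.
  have -> : b i n - b' i = (zn i n - z i) + (T i (zn i n) - T i (z i)).
    by rewrite /b /b' opprD addrACA.
  by rewrite dot_subD// subr_ge0 lerXn2r ?nnegrE//; exact: hT.
have sq0 : \sum_(i < m) `|y i - T i (z i)| ^+ 2 = 0.
  apply/eqP; rewrite eq_le sumr_ge0 ?andbT; last by move=> i _; rewrite sqr_ge0.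
  rewrite -oppr_ge0 -sumrN; apply: le_trans lim_ge0 _.
  (* At the limit the two factors are opposite vectors, so each product is minus a squared norm. *)
  apply: ler_sum => i _.
  have -> : z i - y i - a' i = - (y i - T i (z i)).
    by rewrite !opprB [LHS]addrC addrA subrK.
  have -> : z i + y i - b' i = y i - T i (z i).
    by rewrite opprD addrACA subrr add0r.
  by rewrite linearNl -(dot_normE hdot).
move=> i; apply/esym/eqP; rewrite -subr_eq0 -normr_eq0 -sqrf_eq0.
by have /psumr_eq0P -> := sq0.
Unshelve. all: by end_near. Qed.
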